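(* Let $f$ be a spectral density on $\Lambda$, $c=r(0)=\int_\Lambda f\,d\lambda$, and $\lambda_{1,n}(f)$ the smallest eigenvalue of $T_n(f)$. Then for all $n\in\mathbb N$: (a) if $\overline{E_f}=\Gamma_{2\alpha}(\theta_0)$ with $0<\alpha<\pi$, then $\lambda_{1,n}(f)\le 4c(\sin(\alpha/2))^{2n-2}$; (b) if $\overline{E_f}=\Gamma_{\alpha,\delta}(\theta_0)$ with $\alpha>0$, $\delta\ge0$, $\alpha+\delta\le\pi$, then $\lambda_{1,n}(f)\le 4c(\sin(\alpha/2))^{n-1}(\sin(\alpha/2+\delta))^{n-1}$.
   Context: $\Lambda=[-\pi,\pi]$. A spectral density is $f\ge0$, $f\in L^1(\Lambda)$, positive on a set of positive measure; $r(t)=\int_\Lambda e^{-it\lambda}f(\lambda)d\lambda$; $T_n(f)=(r(k-j))_{j,k=0,\dots,n}$. $E_f=\{e^{i\lambda}:f(\lambda)>0\}$ with closure $\overline{E_f}$. For $\theta_0\in[-\pi,\pi)$: $\Gamma_{2\alpha}(\theta_0)=\{e^{i\theta}:|\theta-\theta_0|\le\alpha\}$; $\Gamma_{\alpha,\delta}(\theta_0)=\{e^{i\theta}:\delta\le|\theta-\theta_0|\le\delta+\alpha\}$. *)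

(* Defs.v *)
From HB Require Import structures.
From mathcomp Require Import all_boot all_order all_algebra.
From mathcomp Require Import all_classical all_reals all_analysis.
From mathcomp Require Import complex.
Import numFieldNormedType.Exports.
Set Implicit Arguments. Unset Strict Implicit. Unset Printing Implicit Defensive.
Import Order.TTheory GRing.Theory Num.Theory.
Local Open Scope classical_set_scope.
Local Open Scope ring_scope.
Local Open Scope complex_scope.

Section Spectral.
Variable R : realType.

Definition Lam : set R := `[- pi, pi]%classic.

Local Notation mu := (@lebesgue_measure R).

Definition spectral_density (f : R -> R) : Prop :=
  [/\ (forall x, Lam x -> (0 <= f x)%R),
      mu.-integrable Lam (EFin \o f)
    & (0 < mu (Lam `&` [set x | (0 < f x)%R]))%E].

(* r(t) = \int_Lambda e^{-i t l} f(l) dl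
        = \int cos(t l) f(l) dl - i \int sin(t l) f(l) dl *)
Definition covariance (f : R -> R) (t : R) : R[i] :=
  (Rintegral mu Lam (fun l => cos (t * l) * f l))
    +i* (- Rintegral mu Lam (fun l => sin (t * l) * f l)).

Definition toeplitz (f : R -> R) (n : nat) : 'M[R[i]]_n.+1 :=
  \matrix_(j < n.+1, k < n.+1) covariance f (k%:R - j%:R).

Definition circ (theta : R) : R * R := (cos theta, sin theta).

Definition Ef (f : R -> R) : set (R * R) :=
  circ @` (Lam `&` [set l | 0 < f l]).

Definition Gamma2 (alpha theta0 : R) : set (R * R) :=
  circ @` [set theta | `|theta - theta0| <= alpha].

Definition Gamma_ad (alpha delta theta0 : R) : set (R * R) :=
  circ @` [set theta | delta <= `|theta - theta0| <= delta + alpha].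

Definition is_min_eigenvalue (m : nat) (A : 'M[R[i]]_m) (l : R) : Prop :=
  eigenvalue A l%:C /\ (forall a : R[i], eigenvalue A a -> l%:C <= a).

End Spectral.

(* Main.v *)
Require Import Defs.
From HB Require Import structures.
From mathcomp Require Import all_boot all_order all_algebra.
From mathcomp Require Import all_classical all_reals all_analysis.
From mathcomp Require Import measurable_realfun complex spectral sesquilinear.
From mathcomp Require Import ring lra zify.
Import numFieldNormedType.Exports.
Import Order.TTheory GRing.Theory Num.Theory.

(* The quadratic form of T_n(f) at the vector of coefficients of a polynomial P
   of degree at most n is the integral of |P(e^{i t})|^2 f(t). Hence, if some
   coefficient of P has modulus at least 1, the smallest eigenvalue is at most
   c sup |P|^2 over E_f. On the arcs delta <= |t - theta0| <= delta + alpha, the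
   number 2 cos(t - theta0) lies in an interval of length 4 r, with
   r = sin(alpha/2) sin(alpha/2 + delta), so the Chebyshev polynomial C_m of that
   interval is at most 2 r^m there, and P(z) = z^m C_m(z + 1/z), rotated by theta0
   and with m = n./2, is admissible. Case (a) is case (b) with delta = 0. *)

Local Open Scope classical_set_scope.
Local Open Scope ring_scope.
Local Open Scope complex_scope.
Local Open Scope sesquilinear_scope.

(** * Rayleigh quotients of Hermitian matrices *)

(** In the orthonormal basis of the spectral theorem, with coordinates [y] of [x], the form is the
    sum of [d 0 i] times the squared modulus of [y 0 i], and each [d 0 i] is an eigenvalue. *)
Lemma min_eigenvalue_le_quadratic_form (C : numClosedFieldType) (n : nat)
    (A : 'M[C]_n) (l : C) (x : 'rV[C]_n) :
  A \is hermsymmx -> (forall a, eigenvalue A a -> l <= a) ->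
  l * (x *m x ^t*) 0 0 <= (x *m A *m x ^t*) 0 0.
Proof.
move=> /hermitian_normalmx/orthomx_spectralP.
set P := spectralmx A; set d := spectral_diag A.
move=> AE lmin.
have Punit : P \is unitarymx := spectral_unitarymx A.
have Pu : P \in unitmx := spectral_unit A.
have PVE : invmx P = P ^t* := invmx_unitary Punit.
have le_d i : l <= d 0 i.
  (* Row [i] of [P] is a left eigenvector; it is nonzero because [P] is invertible. *)
  apply: lmin; apply/eigenvalueP; exists (row i P).
    rewrite -row_mul AE !mulmxA mulmxV// mul1mx.
    by apply/rowP => j; rewrite mul_diag_mx !mxE.
  apply/eqP => Pi0; have := congr1 (fun M => row i M) (mulmxV Pu).
  rewrite row_mul Pi0 mul0mx => /rowP /(_ i); rewrite !mxE eqxx.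
  by move/eqP; rewrite eq_sym oner_eq0.
pose y := x *m P ^t*.
have yE : P *m x ^t* = y ^t* by rewrite /y trmx_mul map_mxM trmxCK.
have -> : x *m A *m x ^t* = y *m diag_mx d *m y ^t*.
  by rewrite AE PVE -yE /y !mulmxA.
have -> : x *m x ^t* = y *m y ^t*.
  by rewrite -yE /y -!mulmxA -PVE (mulmxA (invmx P)) mulVmx// mul1mx.
rewrite !mxE mulr_sumr; apply: ler_sum => i _.
rewrite [in leRHS]mul_mx_diag !mxE [_ * d 0 i]mulrC -mulrA.
by rewrite ler_wpM2r// mul_conjC_ge0.
Qed.

(** * Trigonometric integrals against the density, and the covariance *)

Local Notation mu := (@lebesgue_measure _).

Lemma Rintegral_sum (R : realType) (D : set (measurableTypeR R)) (I : Type) (s : seq I)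
    (F : I -> R -> R) :
  measurable D ->
  (forall i, mu.-integrable D (EFin \o F i)) ->
  mu.-integrable D (EFin \o (fun x => \sum_(i <- s) F i x)) /\
  Rintegral mu D (fun x => \sum_(i <- s) F i x) =
  \sum_(i <- s) Rintegral mu D (F i).
Proof.
move=> mD iF; have iS t : mu.-integrable D
    (EFin \o (fun x => \sum_(i <- t) F i x)).
  have := integrable_sum mD t (P := xpredT) (fun i _ => iF i).
  by apply: eq_integrable => // x _ /=; rewrite -sumEFin.
split=> //; elim: s => [|i s IH].
  rewrite big_nil -[RHS](mul0r (Rintegral mu D (cst 0))).
  rewrite -RintegralZl//; last exact: integrable0.
  by apply: eq_Rintegral => x _; rewrite big_nil mul0r.
rewrite big_cons -IH -RintegralD//.
by apply: eq_Rintegral => x _; rewrite big_cons.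
Qed.

Lemma measurable_Lam (R : realType) : measurable (@Lam R : set (measurableTypeR R)).
Proof. exact: measurable_itv. Qed.

Lemma integrable_contraction_mul (R : realType) (f h : R -> R) :
  mu.-integrable (@Lam R) (EFin \o f) ->
  continuous h -> (forall x, `|h x| <= 1) ->
  mu.-integrable (@Lam R) (EFin \o (fun x => h x * f x)).
Proof.
move=> fi hc h1.
have fm : measurable_fun (@Lam R) f.
  by apply/measurable_EFinP; exact: measurable_int fi.
apply: le_integrable fi => //; first exact: measurable_Lam.
  apply/measurable_EFinP; apply: measurable_funM => //.
  by apply: measurable_funTS; exact: continuous_measurable_fun.
move=> x _ /=; rewrite lee_fin normrM.
by rewrite ler_piMl.
Qed.

Lemma integrable_cosM (R : realType) (f : R -> R) (t s : R) :
  mu.-integrable (@Lam R) (EFin \o f) ->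
  mu.-integrable (@Lam R)
    (EFin \o (fun x => cos (t * (x - s)) * f x)).
Proof.
move=> fi; apply: integrable_contraction_mul => // x; last first.
  by rewrite ler_norml cos_geN1 cos_le1.
apply: continuous_comp; last exact: continuous_cos.
apply: cvgM; first exact: cvg_cst.
by apply: cvgB; [exact: cvg_id|exact: cvg_cst].
Qed.

Lemma integrable_sinM (R : realType) (f : R -> R) (t : R) :
  mu.-integrable (@Lam R) (EFin \o f) ->
  mu.-integrable (@Lam R)
    (EFin \o (fun x => sin (t * x) * f x)).
Proof.
move=> fi; apply: integrable_contraction_mul => // x; last first.
  by rewrite ler_norml sin_geN1 sin_le1.
apply: continuous_comp; last exact: continuous_sin.
by apply: cvgM; [exact: cvg_cst|exact: cvg_id].
Qed.

(** The left side is the real part of e^{its} r(t), and multiplying by e^{its} turns the kernel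
    e^{-itx} into e^{-it(x-s)}. *)
Lemma covariance_rotation (R : realType) (f : R -> R) (t s : R) :
  mu.-integrable (@Lam R) (EFin \o f) ->
  cos (t * s) * complex.Re (Defs.covariance f t)
    - sin (t * s) * complex.Im (Defs.covariance f t) =
  Rintegral mu (@Lam R) (fun x => cos (t * (x - s)) * f x).
Proof.
move=> fi; have mL := @measurable_Lam R.
have ic : mu.-integrable (@Lam R)
    (EFin \o (fun x => cos (t * x) * f x)).
  have := integrable_cosM _ _ t 0 fi; apply: eq_integrable => // x _ /=.
  by rewrite subr0.
have isn := integrable_sinM _ _ t fi.
have iZ (a : R) (g : R -> R) :
    mu.-integrable (@Lam R) (EFin \o g) ->
    mu.-integrable (@Lam R) (EFin \o (fun x => a * g x)).
  by move=> gi; have := integrableZl mL a gi; apply: eq_integrable.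
rewrite /= mulrN opprK -!RintegralZl// -RintegralD//; [|exact: iZ..].
by apply: eq_Rintegral => x _; rewrite mulrBr cosB; ring.
Qed.

Lemma conjCE (R : rcfType) (a b : R) : Num.conj (a +i* b) = a -i* b.
Proof. by []. Qed.

Lemma covarianceN (R : realType) (f : R -> R) (t : R) :
  mu.-integrable (@Lam R) (EFin \o f) ->
  Defs.covariance f (- t) = Num.conj (Defs.covariance f t).
Proof.
move=> fi; rewrite /Defs.covariance conjCE; congr (_ +i* _).
  by apply: eq_Rintegral => x _; rewrite mulNr cosN.
rewrite opprK; apply/eqP; rewrite eqr_oppLR -[- Rintegral _ _ _]mulN1r -RintegralZl.
- by apply/eqP; apply: eq_Rintegral => x _; rewrite mulNr sinN; ring.
- exact: measurable_Lam.
- exact: integrable_sinM.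
Qed.

Lemma toeplitz_hermsym (R : realType) (f : R -> R) (n : nat) :
  mu.-integrable (@Lam R) (EFin \o f) ->
  toeplitz f n \is hermsymmx.
Proof.
move=> fi; apply/is_hermitianmxP; rewrite expr0 scale1r.
by apply/matrixP => j k; rewrite !mxE -covarianceN// opprB.
Qed.

(** * The Toeplitz quadratic form as an integral *)

Lemma Re_sum (R : rcfType) (I : Type) (s : seq I) (F : I -> R[i]) :
  complex.Re (\sum_(i <- s) F i) = \sum_(i <- s) complex.Re (F i).
Proof. by apply: (big_morph (@complex.Re R)) => // -[a b] [c d]. Qed.

(* The complex conjugation in the coefficients makes [x T_n(f) x^*] the integral of
   the squared modulus of [\sum_j p_j e^{i j (t - s)}] against [f]. *)
Definition wave (R : realType) (n : nat) (s : R) (p : 'I_n.+1 -> R) :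
    'rV[R[i]]_n.+1 :=
  \row_(j < n.+1) ((p j)%:C * (cos (j%:R * s) -i* sin (j%:R * s))).

Definition trig_normsq (R : realType) (n : nat) (p : 'I_n.+1 -> R) (u : R) : R :=
  (\sum_(j < n.+1) p j * cos (j%:R * u)) ^+ 2 + (\sum_(j < n.+1) p j * sin (j%:R * u)) ^+ 2.

Lemma trig_normsqE (R : realType) (n : nat) (p : 'I_n.+1 -> R) (u : R) :
  trig_normsq R n p u =
  \sum_(k < n.+1) \sum_(j < n.+1) p j * p k * cos ((k%:R - j%:R) * u).
Proof.
rewrite /trig_normsq !expr2 !mulr_sumr -big_split; apply: eq_bigr => k _ /=.
rewrite !mulr_suml -big_split; apply: eq_bigr => j _ /=.
by rewrite mulrBl cosB; ring.
Qed.

Lemma wave_norm (R : realType) (n : nat) (s : R) (p : 'I_n.+1 -> R) :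
  (wave R n s p *m (wave R n s p) ^t* ) 0 0 = (\sum_(j < n.+1) p j ^+ 2)%:C.
Proof.
rewrite !mxE rmorph_sum; apply: eq_bigr => j _; rewrite !mxE.
have -> : p j ^+ 2 =
    p j ^+ 2 * (cos (j%:R * s) ^+ 2 + sin (j%:R * s) ^+ 2).
  by rewrite cos2Dsin2 mulr1.
apply/eqP; rewrite eq_complex /=; apply/andP; split; apply/eqP; ring.
Qed.

(** The phases of [wave] turn the (j,k) term into p_j p_k e^{i(k-j)s} r(k-j), whose real part is
    given by [covariance_rotation] with t = k - j; [trig_normsqE] sums these terms. Integrability is
    recorded for the later comparison of integrals. *)
Lemma toeplitz_quadratic_form (R : realType) (f : R -> R) (n : nat) (s : R)
    (p : 'I_n.+1 -> R) :
  mu.-integrable (@Lam R) (EFin \o f) ->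
  mu.-integrable (@Lam R)
    (EFin \o (fun x => trig_normsq R n p (x - s) * f x)) /\
  complex.Re ((wave R n s p *m toeplitz f n *m (wave R n s p) ^t* ) 0 0) =
  Rintegral mu (@Lam R)
    (fun x => trig_normsq R n p (x - s) * f x).
Proof.
move=> fi; have mL := @measurable_Lam R.
pose F (k j : 'I_n.+1) x : R :=
  p j * p k * (cos ((k%:R - j%:R) * (x - s)) * f x).
have Fi k j : mu.-integrable (@Lam R) (EFin \o F k j).
  have := integrableZl mL (p j * p k) (integrable_cosM _ _ (k%:R - j%:R) s fi).
  exact: eq_integrable.
have S1 k := Rintegral_sum _ _ _ (index_enum 'I_n.+1) (F k) mL (Fi k).
have [S2i S2] := Rintegral_sum _ _ _ (index_enum 'I_n.+1) _ mL (fun k => (S1 k).1).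
have GE x : \sum_(k < n.+1) \sum_(j < n.+1) F k j x = trig_normsq R n p (x - s) * f x.
  rewrite trig_normsqE mulr_suml; apply: eq_bigr => k _.
  by rewrite mulr_suml; apply: eq_bigr => j _; rewrite /F mulrA.
split; first by apply: eq_integrable S2i => // x _ /=; rewrite GE.
under [RHS]eq_Rintegral do rewrite -GE.
rewrite S2 mxE Re_sum.
apply: eq_bigr => k _; rewrite (S1 k).2 mxE mulr_suml Re_sum.
apply: eq_bigr => j _; rewrite /F RintegralZl//; last exact: integrable_cosM.
rewrite -covariance_rotation// !mxE.
case: (Defs.covariance f _) => a b /=.
by rewrite (mulrBl s k%:R) cosB sinB; ring.
Qed.

(** * Chebyshev polynomials of an interval, lifted to the unit circle *)

(* [z^m C_m(z + 1/z)] with [C_(m+1)(x) = (x - a) C_m(x) - r^2 C_(m-1)(x)], that is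
   [C_m(a + 2 r cos phi) = 2 r^m cos(m phi)]; monic except that [C_0 = 2]. *)
Fixpoint arc_chebyshev (R : comNzRingType) (a r : R) (m : nat) : {poly R} :=
  match m with
  | 0 => 2%:P
  | 1 => 'X^2 - a *: 'X + 1
  | (m'.+1 as m1).+1 =>
      ('X^2 - a *: 'X + 1) * arc_chebyshev R a r m1
      - r ^+ 2 *: ('X^2 * arc_chebyshev R a r m')
  end.

Lemma arc_chebyshevSS (R : comNzRingType) (a r : R) (m : nat) :
  arc_chebyshev R a r m.+2 =
  ('X^2 - a *: 'X + 1) * arc_chebyshev R a r m.+1
  - r ^+ 2 *: ('X^2 * arc_chebyshev R a r m).
Proof. by []. Qed.

Lemma two_step_ind (P : nat -> Prop) :
  P 0 -> P 1 -> (forall m, P m -> P m.+1 -> P m.+2) -> forall m, P m.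
Proof.
move=> P0 P1 PS m; suff [] : P m /\ P m.+1 by [].
by elim: m => // m [Pm Pm1]; split=> //; exact: PS.
Qed.

Lemma arc_chebyshev_coef (R : comNzRingType) (a r : R) (m : nat) :
  (size (arc_chebyshev R a r m) <= m.*2.+1)%N /\
  (arc_chebyshev R a r m)`_(m.*2) = if m == 0 then 2 else 1.
Proof.
elim/two_step_ind: m => [||m [s0 c0] [s1 c1]].
- by rewrite size_polyC coefC /=; case: (_ == _).
- have coef1_eq i : (arc_chebyshev R a r 1)`_i =
      (i == 2)%:R - a * (i == 1)%:R + (i == 0)%:R.
    by rewrite /= !coefD coefN coefZ coefXn coefX coef1.
  split; last by rewrite coef1_eq /= mulr0 subr0 addr0.
  apply/leq_sizeP => -[|[|[|i]]] // _.
  by rewrite coef1_eq /= mulr0 subr0 addr0.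
have vanish0 i : (m.*2 < i)%N -> (arc_chebyshev R a r m)`_i = 0.
  by move=> mi; apply/leq_sizeP: mi.
have vanish1 i : (m.+1.*2 < i)%N -> (arc_chebyshev R a r m.+1)`_i = 0.
  by move=> mi; apply/leq_sizeP: mi.
(* At i = 2(m+1) only the first term survives, so the top coefficient comes from index m+1 alone and
   the value 2 at index 0 does not propagate. *)
have coefSS i : (arc_chebyshev R a r m.+2)`_i.+2 =
    (arc_chebyshev R a r m.+1)`_i - a * (arc_chebyshev R a r m.+1)`_i.+1
    + (arc_chebyshev R a r m.+1)`_i.+2 - r ^+ 2 * (arc_chebyshev R a r m)`_i.
  rewrite arc_chebyshevSS !mulrDl mulNr mul1r -scalerAl.
  by rewrite !(coefD, coefN, coefZ) !coefXnM coefXM /= !subSS !subn0.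
split.
  apply/leq_sizeP => -[|[|i]] //; rewrite doubleS ltnS ltnS => mi.
  rewrite coefSS vanish0 ?vanish1 ?mulr0 ?subr0 ?addr0 //; lia.
rewrite [m.+2.*2]doubleS coefSS c1 vanish0 ?vanish1 ?mulr0 ?subr0 ?addr0 //; lia.
Qed.

(** For z = e^{iu}, z^2 - a z + 1 = z (2 cos u - a) = z (2 r cos phi), so after division by z^m the
    recursion becomes the three-term recurrence of 2 r^m cos(m phi). *)
Lemma arc_chebyshev_eval (R : realType) (a r phi u : R) (m : nat) :
  2 * cos u = a + 2 * r * cos phi ->
  (map_poly (real_complex R) (arc_chebyshev R a r m)).[cos u +i* sin u] =
  (cos u +i* sin u) ^+ m * (2 * r ^+ m * cos (m%:R * phi))%:C.
Proof.
move=> cosE.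
set z := cos u +i* sin u.
have qz : z ^+ 2 - a%:C * z + 1 = z * (2 * r * cos phi)%:C.
  have -> : 2 * r * cos phi = 2 * cos u - a by rewrite cosE; ring.
  have : z ^+ 2 + 1 = z * (2 * cos u)%:C.
    rewrite /z expr2; apply/eqP; rewrite eq_complex /=; apply/andP; split.
      by apply/eqP; have := cos2Dsin2 u; lra.
    by apply/eqP; ring.
  by rewrite rmorphB mulrBr => <-; ring.
have qE : (map_poly (real_complex R) ('X^2 - a *: 'X + 1)).[z] =
    z * (2 * r * cos phi)%:C.
  rewrite -qz !(rmorphD, rmorphN) /= map_polyXn map_polyZ map_polyX rmorph1.
  by rewrite !hornerE.
elim/two_step_ind: m => [||m IH0 IH1].
- rewrite /= map_polyC hornerC mul0r cos0 !expr0 !mulr1.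
  exact: (esym (mul1r _)).
- by rewrite /= qE mul1r !expr1.
- rewrite arc_chebyshevSS; set w := (_ * _)%:C.
  rewrite rmorphB rmorphM /= map_polyZ [map_poly _ ('X^2 * _)]rmorphM /= map_polyXn.
  rewrite hornerD hornerN hornerM hornerZ hornerM IH0 IH1 hornerXn qE /w.
  have -> : cos (m.+2%:R * phi) =
      2 * cos phi * cos (m.+1%:R * phi) - cos (m%:R * phi).
    rewrite (_ : m.+2%:R * phi = m.+1%:R * phi + phi); last first.
      by rewrite -[m.+2]addn1 natrD mulrDl mul1r.
    rewrite (_ : m%:R * phi = m.+1%:R * phi - phi); last first.
      by rewrite -[m.+1]addn1 natrD mulrDl mul1r addrK.
    by rewrite cosD cosB; ring.
  by rewrite !exprS expr0; ring.
Qed.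

Lemma de_moivre (R : realType) (u : R) (j : nat) :
  (cos u +i* sin u) ^+ j = cos (j%:R * u) +i* sin (j%:R * u).
Proof.
elim: j => [|j IH]; first by rewrite mul0r cos0 sin0.
rewrite exprS IH -[j.+1]addn1 natrD mulrDl mul1r cosD sinD.
apply/eqP; rewrite eq_complex /=; apply/andP; split; apply/eqP; ring.
Qed.

(** Since 2m <= n, the n+1 coefficients include all those of the polynomial, so [trig_normsq] is its
    squared modulus at e^{iu}; there the factor z^m has modulus 1 and the cosine is at most 1 in
    absolute value. *)
Lemma trig_normsq_arc_chebyshev (R : realType) (a r phi u : R) (m n : nat) :
  (m.*2 <= n)%N -> 2 * cos u = a + 2 * r * cos phi ->
  trig_normsq R n (fun j => (arc_chebyshev R a r m)`_j) u <=
  4 * (r ^+ m) ^+ 2.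
Proof.
move=> mn cosE; set P := arc_chebyshev R a r m.
have szP : (size (map_poly (real_complex R) P) <= n.+1)%N.
  rewrite (leq_trans (size_poly _ _))// (leq_trans (arc_chebyshev_coef R a r m).1)//.
have PE : (map_poly (real_complex R) P).[cos u +i* sin u] =
    (\sum_(j < n.+1) P`_j * cos (j%:R * u)) +i*
    (\sum_(j < n.+1) P`_j * sin (j%:R * u)).
  rewrite (horner_coef_wide _ szP).
  have sumE (F G : 'I_n.+1 -> R) :
      \sum_(j < n.+1) (F j +i* G j) = (\sum_j F j) +i* (\sum_j G j).
    by elim/big_rec3: _ => //= j x y z _ ->.
  rewrite -sumE; apply: eq_bigr => j _.
  rewrite coef_map de_moivre; apply/eqP; rewrite eq_complex /=.
  by apply/andP; split; apply/eqP; ring.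
have := arc_chebyshev_eval R a r phi u m cosE.
rewrite -/P PE de_moivre => /eqP; rewrite eq_complex /= => /andP[/eqP reE /eqP imE].
rewrite /trig_normsq reE imE.
set w := 2 * r ^+ m * cos (m%:R * phi).
have -> : (cos (m%:R * u) * w - sin (m%:R * u) * 0) ^+ 2 +
    (cos (m%:R * u) * 0 + sin (m%:R * u) * w) ^+ 2 =
    (cos (m%:R * u) ^+ 2 + sin (m%:R * u) ^+ 2) * w ^+ 2 by ring.
rewrite cos2Dsin2 mul1r /w !exprMn (_ : 2 ^+ 2 = 4); last by ring.
by rewrite ler_piMr// ?(mulr_ge0 _ (sqr_ge0 _)).
Qed.

(** * Geometry of the arcs and the eigenvalue bound *)

(** The interval from 2 cos(delta + alpha) to 2 cos delta has midpoint cos delta + cos(delta +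
    alpha) and, by the product formula, half-length 2 r; phi is the arccosine of the rescaled
    coordinate. *)
Lemma arc_cos_param (R : realType) (alpha delta u : R) :
  0 < sin (alpha / 2) * sin (alpha / 2 + delta) ->
  cos (delta + alpha) <= cos u <= cos delta ->
  exists phi, 2 * cos u = (cos delta + cos (delta + alpha))
    + 2 * (sin (alpha / 2) * sin (alpha / 2 + delta)) * cos phi.
Proof.
set r := (X in 0 < X) => r0 /andP[ge_cos le_cos].
have diffE : cos delta - cos (delta + alpha) = 2 * r.
  have cosBD (x h : R) : cos (x - h) - cos (x + h) = 2 * (sin h * sin x).
    by rewrite cosB cosD; ring.
  by rewrite /r -cosBD; congr (cos _ - cos _); lra.
set a := cos delta + _; exists (acos ((2 * cos u - a) / (2 * r))).
rewrite -/r acosK; first by field; rewrite gt_eqF.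
have r2 : 0 < 2 * r by lra.
rewrite in_itv /= ler_pdivlMr ?ler_pdivrMr// /a.
by apply/andP; split; lra.
Qed.

(** The point [circ x] fixes [x] only modulo 2 pi, so the cosine is computed at the angle [t] that
    witnesses membership. Cosine is even and decreasing on [0, pi], where |t - theta0| lies. *)
Lemma Gamma_ad_cos (R : realType) (alpha delta theta0 x : R) :
  0 <= alpha -> 0 <= delta -> alpha + delta <= pi ->
  Gamma_ad alpha delta theta0 (circ x) ->
  cos (delta + alpha) <= cos (x - theta0) <= cos delta.
Proof.
move=> a0 d0 ad [t /= /andP[dt ta]] [ct st].
rewrite cosB -ct -st -cosB -(cos_norm (t - theta0)).
by rewrite !leNgt !ltr_cos -?leNgt ?in_itv/=; apply/andP; split; lra.
Qed.

Lemma min_eigenvalue_arc_bound (R : realType) (f : R -> R)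
    (theta0 alpha delta l : R) (n : nat) :
  spectral_density f -> 0 < alpha -> 0 <= delta -> alpha + delta <= pi ->
  0 < sin (alpha / 2) * sin (alpha / 2 + delta) ->
  Ef f `<=` Gamma_ad alpha delta theta0 ->
  is_min_eigenvalue (toeplitz f n) l ->
  l <= 4 * Rintegral mu (@Lam R) f *
       (sin (alpha / 2) * sin (alpha / 2 + delta)) ^+ n./2.*2.
Proof.
move=> [f0 fi _] a0 d0 ad; set r := _ * sin _ => r0 Esub [_ lmin].
have mL := @measurable_Lam R.
pose m := n./2; have mn : (m.*2 <= n)%N by rewrite /m; lia.
pose P := arc_chebyshev R (cos delta + cos (delta + alpha)) r m.
pose p (j : 'I_n.+1) := P`_j.
have := min_eigenvalue_le_quadratic_form _ _ _ _ (wave R n theta0 p)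
  (toeplitz_hermsym _ _ n fi) lmin.
rewrite wave_norm.
have [Gi] := toeplitz_quadratic_form R f n theta0 p fi.
(* The order on [R[i]] asks for equal imaginary parts and ordered real parts; the latter give the
   real inequality. *)
case: (X in complex.Re X) => re im /= reE; rewrite lecE /= => /andP[_].
rewrite mulr0 subr0 reE => quad.
have Gle : Rintegral mu (@Lam R) (fun x => trig_normsq R n p (x - theta0) * f x)
    <= 4 * (r ^+ m) ^+ 2 * Rintegral mu (@Lam R) f.
  rewrite -RintegralZl//; apply: le_Rintegral => //.
    have := integrableZl mL (4 * (r ^+ m) ^+ 2) fi; exact: eq_integrable.
  (* Where f vanishes both integrands are zero; elsewhere [circ x] is in [Ef f], hence on the
     arc. *)
  move=> x Lx; have := f0 x Lx; rewrite le_eqVlt => /predU1P[<-|fx].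
    by rewrite !mulr0.
  rewrite ler_wpM2r ?(ltW fx)//.
  have /(Gamma_ad_cos _ _ _ _ _ (ltW a0) d0 ad) : Gamma_ad alpha delta theta0 (circ x).
    by apply: Esub; exists x.
  by move=> /(arc_cos_param _ _ _ _ r0)[phi]; exact: trig_normsq_arc_chebyshev.
have p1 : 1 <= \sum_(j < n.+1) p j ^+ 2.
  have lt_mn : (m.*2 < n.+1)%N by rewrite ltnS.
  rewrite (bigD1 (Ordinal lt_mn)) //=; apply: ler_wpDr.
    by apply: sumr_ge0 => j _; exact: sqr_ge0.
  rewrite /p /= (arc_chebyshev_coef _ _ _ m).2.
  by case: ifP => _; rewrite ?expr1n// -natrX ler1n.
have c0 : 0 <= Rintegral mu (@Lam R) f by exact: Rintegral_ge0.
(* The lower bound [p1] lets the norm be dropped only for l >= 0; a negative l is below the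
   nonnegative right side. *)
rewrite -muln2 exprM mulrAC; have [l0|l0] := ltP l 0.
  by rewrite (le_trans (ltW l0))// !mulr_ge0// ?exprn_ge0// (ltW r0).
by apply: le_trans (le_trans quad Gle); rewrite ler_peMr.
Qed.

Local Close Scope sesquilinear_scope.
Local Close Scope complex_scope.

(** * From the even exponent to the integer exponent n - 1 *)

(** For n > 0 the even part of n is at least n - 1 and powers of r decrease; for n = 0 the right
    side is the inverse of r, at least 1. *)
Lemma exprn_half_le_exprz (R : realFieldType) (r : R) (n : nat) :
  0 < r <= 1 -> r ^+ n./2.*2 <= r ^ (n%:Z - 1).
Proof.
move=> /andP[r0 r1]; case: n => [|n].
  by rewrite expr0 sub0r -invr_expz expr1z invf_ge1.
have -> : n.+1%:Z - 1 = n by lia.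
by rewrite -exprnP ler_wiXn2l// ?(ltW r0)//; lia.
Qed.

Theorem mainTheorem19 (R : realType) (f : R -> R) (theta0 : R) (n : nat) :
  spectral_density f -> - pi <= theta0 < pi ->
  let c := Rintegral (@lebesgue_measure R) (@Lam R) f in
  (forall alpha : R, 0 < alpha < pi ->
     closure (Ef f) = Gamma2 alpha theta0 ->
     forall l : R, is_min_eigenvalue (toeplitz f n) l ->
       l <= 4 * c * sin (alpha / 2) ^ (2 * (n%:Z) - 2)%R) /\
  (forall alpha delta : R, 0 < alpha -> 0 <= delta -> alpha + delta <= pi ->
     closure (Ef f) = Gamma_ad alpha delta theta0 ->
     forall l : R, is_min_eigenvalue (toeplitz f n) l ->
       l <= 4 * c * sin (alpha / 2) ^ (n%:Z - 1)%R
                  * sin (alpha / 2 + delta) ^ (n%:Z - 1)%R).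
Proof.
move=> fsd _ c.
have bound_ad alpha delta : 0 < alpha -> 0 <= delta -> alpha + delta <= pi ->
    closure (Ef f) = Gamma_ad alpha delta theta0 ->
    forall l : R, is_min_eigenvalue (toeplitz f n) l ->
    l <= 4 * c * sin (alpha / 2) ^ (n%:Z - 1)%R
               * sin (alpha / 2 + delta) ^ (n%:Z - 1)%R.
  move=> a0 d0 ad Ecl l lmin.
  have s1 : 0 < sin (alpha / 2) by apply: sin_gt0_pi; lra.
  have s2 : 0 < sin (alpha / 2 + delta) by apply: sin_gt0_pi; lra.
  have r0 : 0 < sin (alpha / 2) * sin (alpha / 2 + delta) by rewrite mulr_gt0.
  have Esub : Ef f `<=` Gamma_ad alpha delta theta0.
    by rewrite -Ecl; exact: subset_closure.
  rewrite -mulrA -exprzMl ?unitfE ?gt_eqF//.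
  apply: le_trans (min_eigenvalue_arc_bound _ _ _ _ _ _ _ fsd a0 d0 ad r0 Esub lmin) _.
  rewrite ler_wpM2l ?mulr_ge0 ?Rintegral_ge0//; first by case: fsd.
  apply: exprn_half_le_exprz; rewrite r0 /=.
  by rewrite mulr_ile1 ?sin_le1 ?ltW.
split=> [alpha /andP[a0 api] Ecl l lmin|]; last exact: bound_ad.
(* The power splits into the two factors of (b) at delta = 0. The exponent n - 1 may be -1, so
   splitting uses that the sine is nonzero. *)
have -> : 2 * n%:Z - 2 = (n%:Z - 1) + (n%:Z - 1) by ring.
rewrite expfzDr ?gt_eqF//; last by apply: sin_gt0_pi; lra.
rewrite mulrA -[X in _ * sin X ^ _]addr0; apply: bound_ad => //; [lra|].
rewrite Ecl /Gamma2 /Gamma_ad; congr (_ @` _); apply/seteqP; split=> t /=.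
  by rewrite add0r normr_ge0.
by rewrite add0r => /andP[].
Qed.
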